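(* Let $r,s\ge1$ and let $P,Q,A_1,\dots,A_r,B_1,\dots,B_s\in\mathbb{C}^{N\times N}$ be pairwise commuting matrices such that $\Re(P)>0$, $\Re(Q)>0$, $B_j+\ell I$ is invertible for all integers $\ell\ge0$ and $1\le j\le s$, and $B_1-I$ is invertible. Let $x>0$. Then $$(A_1-B_1+I)\;{}_re_s\left[(x,P,Q;z)\left|\begin{matrix}A_1,A_2,\dots,A_r\\ B_1,B_2,\dots,B_s\end{matrix}\right.\right]=A_1\;{}_re_s\left[(x,P,Q;z)\left|\begin{matrix}A_1+I,A_2,\dots,A_r\\ B_1,B_2,\dots,B_s\end{matrix}\right.\right]-(B_1-I)\;{}_re_s\left[(x,P,Q;z)\left|\begin{matrix}A_1,A_2,\dots,A_r\\ B_1-I,B_2,\dots,B_s\end{matrix}\right.\right]$$ and $$(A_1-B_1+I)\;{}_rE_s\left[(x,P,Q;z)\left|\begin{matrix}A_1,A_2,\dots,A_r\\ B_1,B_2,\dots,B_s\end{matrix}\right.\right]=A_1\;{}_rE_s\left[(x,P,Q;z)\left|\begin{matrix}A_1+I,A_2,\dots,A_r\\ B_1,B_2,\dots,B_s\end{matrix}\right.\right]-(B_1-I)\;{}_rE_s\left[(x,P,Q;z)\left|\begin{matrix}A_1,A_2,\dots,A_r\\ B_1-I,B_2,\dots,B_s\end{matrix}\right.\right].$$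
   Context: $I$ is the identity matrix in $\mathbb{C}^{N\times N}$; $t^{M}=\exp(M\ln t)$ for $t>0$; $\Re(M)>0$ means that every eigenvalue of $M$ has positive real part. For $\Re(M)>0$ and $x>0$: $\gamma(M,x)=\int_0^x u^{M-I}e^{-u}du$, $\Gamma(M,x)=\int_x^\infty u^{M-I}e^{-u}du$, $\Gamma(M)=\int_0^\infty u^{M-I}e^{-u}du$, $\Gamma^{-1}(M)=\Gamma(M)^{-1}$. Pochhammer symbol: $(M)_0=I$, $(M)_\ell=M(M+I)\cdots(M+(\ell-1)I)$. The generalized incomplete exponential matrix functions are $${}_re_s\left[(x,P,Q;z)\left|\begin{matrix}A_1,\dots,A_r\\ B_1,\dots,B_s\end{matrix}\right.\right]=\sum_{\ell=0}^\infty \frac{z^\ell}{\ell!}\prod_{i=1}^r(A_i)_\ell\Big[\prod_{j=1}^s(B_j)_\ell\Big]^{-1}\gamma(\ell P+Q,x)\Gamma^{-1}(\ell P+Q),$$ $${}_rE_s\left[(x,P,Q;z)\left|\begin{matrix}A_1,\dots,A_r\\ B_1,\dots,B_s\end{matrix}\right.\right]=\sum_{\ell=0}^\infty \frac{z^\ell}{\ell!}\prod_{i=1}^r(A_i)_\ell\Big[\prod_{j=1}^s(B_j)_\ell\Big]^{-1}\Gamma(\ell P+Q,x)\Gamma^{-1}(\ell P+Q).$$ The identities are understood for those $z\in\mathbb{C}$ for which the series involved converge. *)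

(* Defs.v *)
From mathcomp Require Import all_boot all_order all_algebra.
From mathcomp Require Import complex.
From mathcomp Require Import all_classical all_reals all_analysis.

Set Implicit Arguments.
Unset Strict Implicit.
Unset Printing Implicit Defensive.

Import Order.TTheory GRing.Theory Num.Theory.
Import numFieldNormedType.Exports.

Local Open Scope classical_set_scope.
Local Open Scope ring_scope.

(* The complex numbers over R.  Going through numClosedFieldType makes the
   topology induced by the modulus available, hence also the entrywise topology
   on matrices; the bare type R[i] carries no topology. *)
Definition Cplx (R : realType) : numClosedFieldType := R[i]%C.

(* Limits are total: the value is meaningful when the series converges. *)
Definition expmx (R : realType) (N : nat) (M : 'M[Cplx R]_N) : 'M[Cplx R]_N :=
  limn (series (fun k => (k`!%:R^-1 : Cplx R) *: M ^+ k)).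

Definition rpowmx (R : realType) (N : nat) (t : R) (M : 'M[Cplx R]_N) :
    'M[Cplx R]_N :=
  expmx (((ln t)%:C)%C *: M).

(* The condition written Re(M) > 0. *)
Definition positive_stable (R : realType) (N : nat) (M : 'M[Cplx R]_N) : Prop :=
  forall a : Cplx R, eigenvalue M a -> 0 < complex.Re a.

(* The Lebesgue integral agrees with the improper Riemann integral here: the
   gamma integrands below are absolutely integrable when Re(M) > 0. *)
Definition integral_mx (R : realType) (N : nat) (D : set R)
    (f : R -> 'M[Cplx R]_N) : 'M[Cplx R]_N :=
  \matrix_(i, j)
    ((\int[lebesgue_measure]_(u in D) complex.Re (f u i j))
     +i* (\int[lebesgue_measure]_(u in D) complex.Im (f u i j)))%C.

Definition gamma_integrand (R : realType) (N : nat) (M : 'M[Cplx R]_N) (u : R) :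
    'M[Cplx R]_N :=
  (expR (- u))%:C%C *: rpowmx u (M - 1%:M).

Definition lower_gamma (R : realType) (N : nat) (M : 'M[Cplx R]_N) (x : R) :=
  integral_mx `]0, x] (gamma_integrand M).

Definition upper_gamma (R : realType) (N : nat) (M : 'M[Cplx R]_N) (x : R) :=
  integral_mx `[x, +oo[ (gamma_integrand M).

Definition gamma_mx (R : realType) (N : nat) (M : 'M[Cplx R]_N) :=
  integral_mx `]0, +oo[ (gamma_integrand M).

Definition pochhammer (R : realType) (N : nat) (M : 'M[Cplx R]_N) (l : nat) :
    'M[Cplx R]_N :=
  \prod_(k < l) (M + k%:R%:M).

(* Common shape of the general terms of the two series; G is the incomplete
   gamma function M |-> gamma(M, x) or M |-> Gamma(M, x). *)
Definition hyper_term (R : realType) (N r s : nat)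
    (G : 'M[Cplx R]_N -> 'M[Cplx R]_N) (P Q : 'M[Cplx R]_N)
    (A : 'I_r -> 'M[Cplx R]_N) (B : 'I_s -> 'M[Cplx R]_N) (z : Cplx R)
    (l : nat) : 'M[Cplx R]_N :=
  (z ^+ l / l`!%:R) *:
    ((\prod_(i < r) pochhammer (A i) l)
     *m invmx (\prod_(j < s) pochhammer (B j) l)
     *m G (P *+ l + Q) *m invmx (gamma_mx (P *+ l + Q))).

Definition e_term (R : realType) (N r s : nat) (x : R) (P Q : 'M[Cplx R]_N)
    (A : 'I_r -> 'M[Cplx R]_N) (B : 'I_s -> 'M[Cplx R]_N) (z : Cplx R) :
    nat -> 'M[Cplx R]_N :=
  hyper_term (fun M => lower_gamma M x) P Q A B z.

Definition E_term (R : realType) (N r s : nat) (x : R) (P Q : 'M[Cplx R]_N)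
    (A : 'I_r -> 'M[Cplx R]_N) (B : 'I_s -> 'M[Cplx R]_N) (z : Cplx R) :
    nat -> 'M[Cplx R]_N :=
  hyper_term (fun M => upper_gamma M x) P Q A B z.

Definition e_converges (R : realType) (N r s : nat) (x : R)
    (P Q : 'M[Cplx R]_N) (A : 'I_r -> 'M[Cplx R]_N)
    (B : 'I_s -> 'M[Cplx R]_N) (z : Cplx R) : Prop :=
  cvgn (series (e_term x P Q A B z)).

Definition E_converges (R : realType) (N r s : nat) (x : R)
    (P Q : 'M[Cplx R]_N) (A : 'I_r -> 'M[Cplx R]_N)
    (B : 'I_s -> 'M[Cplx R]_N) (z : Cplx R) : Prop :=
  cvgn (series (E_term x P Q A B z)).

Definition e_fun (R : realType) (N r s : nat) (x : R) (P Q : 'M[Cplx R]_N)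
    (A : 'I_r -> 'M[Cplx R]_N) (B : 'I_s -> 'M[Cplx R]_N) (z : Cplx R) :
    'M[Cplx R]_N :=
  limn (series (e_term x P Q A B z)).

Definition E_fun (R : realType) (N r s : nat) (x : R) (P Q : 'M[Cplx R]_N)
    (A : 'I_r -> 'M[Cplx R]_N) (B : 'I_s -> 'M[Cplx R]_N) (z : Cplx R) :
    'M[Cplx R]_N :=
  limn (series (E_term x P Q A B z)).

Definition set_first (T : Type) (r : nat) (F : 'I_r.+1 -> T) (M : T) :
    'I_r.+1 -> T :=
  [eta F with ord0 |-> M].

(* Main.v *)
(** The identity holds term by term, for any matrix function in place of the
    incomplete gamma function: since [M (M + I)_l = (M)_l (M + l I)], with
    [C := B_1 - I] both terms on the right become multiples of the l-th term on
    the left, with factors [A_1 + l I] and [C + l I], whose difference is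
    [A_1 - B_1 + I].  Left multiplication by a matrix is continuous, so the
    relation passes to the limit. *)
Require Import Defs.
From mathcomp Require Import all_boot all_order all_algebra.
From mathcomp Require Import complex.
From mathcomp Require Import all_classical all_reals all_analysis.

Set Implicit Arguments.
Unset Strict Implicit.
Unset Printing Implicit Defensive.

Import Order.TTheory GRing.Theory Num.Theory.
Import numFieldNormedType.Exports.

Local Open Scope classical_set_scope.
Local Open Scope ring_scope.

Lemma mulmx_continuous (K : numFieldType) (m n p : nat) (M : 'M[K]_(m, n)) :
  continuous (mulmx M : 'M[K]_(n, p) -> 'M[K]_(m, p)).
Proof.
move=> X S [P nbhsP PS].
(* Matrix neighbourhoods are boxes of entrywise neighbourhoods [P i j]; as there are finitely many
   entries, each can be treated separately, where it is a finite sum of scaled coordinates. *)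
suff : \forall Y \near X, forall i j, P i j ((M *m Y) i j).
  by rewrite /= nbhs_simpl /=; apply: filterS => Y PY; exact: PS.
apply: (filter_forall (F := nbhs X)) => i.
apply: (filter_forall (F := nbhs X)) => j.
have coord_cvg : continuous (fun Y : 'M[K]_(n, p) => (M *m Y) i j).
  rewrite (_ : (fun _ => _) = (fun Y : 'M[K]_(n, p) => \sum_k M i k * Y k j)).
    apply: (continuous_big (op := +%R)) => [|k _ Y]; first exact: add_continuous.
    by apply: (cvgMl_tmp (F := nbhs Y)); exact: coord_continuous.
  by apply/funext => Y; rewrite mxE.
exact: (coord_cvg X _ (nbhsP i j)).
Qed.

Lemma cvg_series_mulmx (K : numFieldType) (n : nat) (M L : 'M[K]_n)
    (u : nat -> 'M[K]_n) :
  series u @ \oo --> L -> series (fun l => M *m u l) @ \oo --> M *m L.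
Proof.
move=> uL; rewrite (_ : series _ = mulmx M \o series u).
  by apply: continuous_cvg uL; exact: mulmx_continuous.
by apply/funext => l; rewrite /series /= mulmx_sumr.
Qed.

(** Both sides are limits of the partial sums of [X *m u l], so uniqueness of limits identifies
    them. *)
Lemma limn_series_mulmxB (K : numFieldType) (n : nat) (X Y Z : 'M[K]_n)
    (u v w : nat -> 'M[K]_n) :
  (forall l, X *m u l = Y *m v l - Z *m w l) ->
  cvgn (series u) -> cvgn (series v) -> cvgn (series w) ->
  X *m limn (series u) = Y *m limn (series v) - Z *m limn (series w).
Proof.
move=> uvw cu cv cw.
have lu := cvg_series_mulmx (M := X) cu.
have lv := cvg_series_mulmx (M := Y) cv.
have lw := cvg_series_mulmx (M := Z) cw.
apply: (cvg_unique _ lu) => //.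
rewrite (_ : series _ =
  series (fun l => Y *m v l) - series (fun l => Z *m w l)); first exact: cvgB.
apply/funext => l; rewrite /series !fctE -sumrB.
by apply: eq_bigr => k _; rewrite uvw.
Qed.

Lemma comm_mxV (K : comUnitRingType) (n : nat) (X Y : 'M[K]_n) :
  comm_mx X Y -> comm_mx X (invmx Y).
Proof.
(* [invmx] returns a singular matrix unchanged, so that case is the hypothesis itself. *)
have [Yu|Ynu] := boolP (Y \in unitmx); last by rewrite invmx_out.
by move=> XY; rewrite /comm_mx -[LHS](mulKmx Yu) [Y *m (X *m _)]mulmxA -XY mulmxK.
Qed.

Section Pochhammer.
Variables (R : realType) (N : nat).
Implicit Types M X : 'M[Cplx R]_N.

Lemma pochhammerSr M l :
  pochhammer M l.+1 = pochhammer M l *m (M + l%:R%:M).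
Proof. by rewrite /pochhammer big_ord_recr. Qed.

(** Peels off the factor k = 0, using M + (k+1)I = (M+I) + kI. Compared with [pochhammerSr], it
    yields M (M+I)_l = (M)_l (M + l I), which governs both parameter shifts. *)
Lemma pochhammerSl M l :
  pochhammer M l.+1 = M *m pochhammer (M + 1%:M) l.
Proof.
rewrite /pochhammer big_ord_recl /= raddf0 addr0; congr (_ *m _).
by apply: eq_bigr => k _; rewrite -addrA -raddfD /= -mulrS.
Qed.

Lemma comm_mxDscalar X M a : comm_mx X M -> comm_mx X (M + a%:M).
Proof. by move=> XM; apply: comm_mxD => //; exact: comm_mx_scalar. Qed.

Lemma comm_pochhammer X M l : comm_mx X M -> comm_mx X (pochhammer M l).
Proof. by move=> XM; apply: commr_prod => k _; exact: comm_mxDscalar. Qed.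

Lemma pochhammer_unit M l :
  (forall k, M + k%:R%:M \in unitmx) -> pochhammer M l \in unitmx.
Proof.
move=> Mu; elim: l => [|l IHl]; first by rewrite /pochhammer big_ord0 unitmx1.
by rewrite pochhammerSr unitmx_mul IHl Mu.
Qed.

Lemma prod_pochhammer_unit n (F : 'I_n -> 'M[Cplx R]_N) l :
  (forall i k, F i + k%:R%:M \in unitmx) ->
  \prod_(i < n) pochhammer (F i) l \in unitmx.
Proof.
move=> Fu; elim/big_ind: _ => [|X Y Xu Yu|i _]; first exact: unitmx1.
  by rewrite unitmx_mul Xu.
exact: pochhammer_unit (Fu i).
Qed.

End Pochhammer.

Lemma hyper_term_contiguous (R : realType) (N r s : nat)
    (G : 'M[Cplx R]_N -> 'M[Cplx R]_N) (P Q : 'M[Cplx R]_N)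
    (A : 'I_r.+1 -> 'M[Cplx R]_N) (B : 'I_s.+1 -> 'M[Cplx R]_N) (z : Cplx R)
    (l : nat) :
  (forall i, comm_mx (A ord0) (A i)) ->
  (forall i, comm_mx (B ord0) (A i)) ->
  (forall j, comm_mx (B ord0) (B j)) ->
  (forall j k, B j + k%:R%:M \in unitmx) ->
  B ord0 - 1%:M \in unitmx ->
  (A ord0 - B ord0 + 1%:M) *m hyper_term G P Q A B z l =
    A ord0 *m hyper_term G P Q (set_first A (A ord0 + 1%:M)) B z l
    - (B ord0 - 1%:M) *m
      hyper_term G P Q A (set_first B (B ord0 - 1%:M)) z l.
Proof.
move=> AA BA BB Bu B1u; rewrite /hyper_term.
set C := B ord0 - 1%:M.
set U := \prod_(i < r.+1) pochhammer (A i) l.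
set V := \prod_(j < s.+1) pochhammer (B j) l.
set U' := \prod_(i < r.+1) pochhammer _ l.
set V' := \prod_(j < s.+1) pochhammer _ l.
have CB X : comm_mx (B ord0) X -> comm_mx C X.
  move=> BX; apply/comm_mx_sym; rewrite /C -raddfN.
  exact/comm_mxDscalar/comm_mx_sym.
have C1 : C + 1%:M = B ord0 by rewrite /C subrK.
have CU : comm_mx C U.
  by apply: commr_prod => i _; apply/comm_pochhammer/CB.
have CV : comm_mx C V.
  by apply: commr_prod => j _; apply/comm_pochhammer/CB; exact: BB.
(* [U'] differs from [U] only in its first factor, so the shift identity for M = A_1 suffices. *)
have AU' : A ord0 *m U' = (A ord0 + l%:R%:M) *m U.
  rewrite /U' /U !big_ord_recl /= -!mulmxE !mulmxA -pochhammerSl pochhammerSr.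
  congr (_ *m _); apply/comm_mx_sym/comm_pochhammer/comm_mx_sym.
  exact: comm_mxDscalar.
(* The shift identity for M = C, where C + I = B_1: here the unprimed product is the shifted one. *)
have CV' : C *m V = (C + l%:R%:M) *m V'.
  rewrite /V' /V !big_ord_recl /= -!mulmxE !mulmxA -{1}C1 -pochhammerSl.
  rewrite pochhammerSr.
  congr (_ *m _); apply/comm_mx_sym/comm_pochhammer/comm_mx_sym.
  exact: comm_mxDscalar.
have Vu : V \in unitmx by exact: prod_pochhammer_unit.
(* For the lowered parameter, C + kI is B_1 - I when k = 0 and B_1 + (k-1)I otherwise. *)
have V'u : V' \in unitmx.
  apply: prod_pochhammer_unit => j k; rewrite /set_first /=.
  case: eqP => _; last exact: Bu.
  case: k => [|k]; first by rewrite raddf0 addr0.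
  rewrite -add1n natrD raddfD /= addrA C1; exact: Bu.
have CcV' : comm_mx C V'.
  rewrite /V' big_ord_recl /=; apply: comm_mxM.
    exact/comm_pochhammer/comm_mx_refl.
  by apply: commr_prod => j _; apply/comm_pochhammer/CB; exact: BB.
(* C V'^-1 = V'^-1 (C V) V^-1 = V'^-1 V' (C + l I) V^-1, and V' cancels. *)
have CinvV' : C *m invmx V' = (C + l%:R%:M) *m invmx V.
  have ClV' : comm_mx (C + l%:R%:M) V'.
    by apply/comm_mx_sym/comm_mxDscalar/comm_mx_sym.
  rewrite (comm_mxV CcV') -[in LHS](mulmxK Vu C) CV' ClV'.
  by rewrite -(mulmxA V') mulKmx.
have ClU : comm_mx (C + l%:R%:M) U.
  by apply/comm_mx_sym/comm_mxDscalar/comm_mx_sym.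
(* The l I cancel, leaving a coefficient independent of l, as summation requires. *)
have coefE : A ord0 + l%:R%:M - (C + l%:R%:M) = A ord0 - B ord0 + 1%:M.
  by rewrite opprD addrACA subrr addr0 /C opprB addrA addrAC.
(* C passes through [U] to meet [invmx V'], becomes C + l I, and returns to the left of [U]; the
   gamma factors stay on the right. *)
rewrite -!scalemxAr -scalerBr !mulmxA AU' CU -[U *m C *m _]mulmxA CinvV'.
by rewrite !mulmxA -ClU -!mulmxBl coefE.
Qed.

Theorem theorem3p15 (R : realType) (N r s : nat) (P Q : 'M[Cplx R]_N)
    (A : 'I_r.+1 -> 'M[Cplx R]_N) (B : 'I_s.+1 -> 'M[Cplx R]_N) (x : R)
    (commPQAB : {in P :: Q :: codom A ++ codom B &,
       forall X Y : 'M[Cplx R]_N, comm_mx X Y})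
    (P_gt0 : positive_stable P) (Q_gt0 : positive_stable Q)
    (B_unit : forall (j : 'I_s.+1) (l : nat), B j + l%:R%:M \in unitmx)
    (B1_unit : B ord0 - 1%:M \in unitmx)
    (x_gt0 : 0 < x) (z : Cplx R) :
  (e_converges x P Q A B z ->
   e_converges x P Q (set_first A (A ord0 + 1%:M)) B z ->
   e_converges x P Q A (set_first B (B ord0 - 1%:M)) z ->
   (A ord0 - B ord0 + 1%:M) *m e_fun x P Q A B z =
     A ord0 *m e_fun x P Q (set_first A (A ord0 + 1%:M)) B z
     - (B ord0 - 1%:M) *m e_fun x P Q A (set_first B (B ord0 - 1%:M)) z)
  /\
  (E_converges x P Q A B z ->
   E_converges x P Q (set_first A (A ord0 + 1%:M)) B z ->
   E_converges x P Q A (set_first B (B ord0 - 1%:M)) z ->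
   (A ord0 - B ord0 + 1%:M) *m E_fun x P Q A B z =
     A ord0 *m E_fun x P Q (set_first A (A ord0 + 1%:M)) B z
     - (B ord0 - 1%:M) *m E_fun x P Q A (set_first B (B ord0 - 1%:M)) z).
Proof.
have comAB X Y : X \in codom A ++ codom B -> Y \in codom A ++ codom B ->
    comm_mx X Y.
  by move=> Xin Yin; apply: commPQAB; rewrite !inE ?Xin ?Yin !orbT.
have Ain i : A i \in codom A ++ codom B by rewrite mem_cat codom_f.
have Bin j : B j \in codom A ++ codom B by rewrite mem_cat codom_f orbT.
(* The two identities are the instances of [G] at the lower and upper incomplete gamma functions. *)
by split; apply: limn_series_mulmxB => l; apply: hyper_term_contiguous => // *;
  apply: comAB.
Qed.
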